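(* Let $A=(a_{ij})\in\mathbb{R}^{[m]\times[n]}$. If $A$ is universally connected, then $A$ does not have a forbidden pattern.
   Context: Fix a positive integer $d$ and let $D=\{0,1,\dots,d\}$; write $[k]=\{1,\dots,k\}$. For $A\in\mathbb{R}^{[m]\times[n]}$ and $b\in\mathbb{R}^{[m]}$, the set of feasible solutions is $R(A,b)=\{x\in D^{[n]}: Ax\ge b\}$. The solution graph $G(A,b)$ is the undirected graph with vertex set $R(A,b)$ in which $x,y$ are adjacent iff they differ in exactly one coordinate (Hamming distance $1$). $A$ is universally connected if $G(A,b)$ is connected for every $b\in\mathbb{R}^{[m]}$. A pair $(I,J)$ with $I\subseteq[m]$, $J\subseteq[n]$, $|I|=|J|=\lambda\neq 0$, is a forbidden pattern in $A$ if there are orderings $I=\{i_1,\dots,i_\lambda\}$, $J=\{j_1,\dots,j_\lambda\}$ such that, with $i_{\lambda+1}:=i_1$, for every $\ell\in[\lambda]$: $a_{ij_\ell}=0$ for all $i\in I\setminus\{i_\ell,i_{\ell+1}\}$, and $a_{i_\ell j_\ell}a_{i_{\ell+1}j_\ell}<0$. ''$A$ has a forbidden pattern'' means some such $(I,J)$ exists. *)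

(* Defs.v *)
From mathcomp Require Import all_boot all_order all_algebra.
From mathcomp Require Import reals.

Set Implicit Arguments.
Unset Strict Implicit.
Unset Printing Implicit Defensive.

Import Order.TTheory GRing.Theory Num.Theory.
Local Open Scope ring_scope.

(* D = {0, ..., d} is 'I_d.+1, so D^[n] is the finite type 'cV['I_d.+1]_n. *)
Definition realvec (R : realType) (d n : nat) (x : 'cV['I_d.+1]_n) : 'cV[R]_n :=
  map_mx (fun k : 'I_d.+1 => (nat_of_ord k)%:R) x.

Definition feasible (R : realType) (d m n : nat)
    (A : 'M[R]_(m, n)) (b : 'cV[R]_m) : {set 'cV['I_d.+1]_n} :=
  [set x | [forall i, b i 0 <= (A *m realvec R x) i 0]].

Definition hamming (T : eqType) (n : nat) (x y : 'cV[T]_n) : nat :=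
  #|[set j | x j 0 != y j 0]|.

Definition solution_graph (R : realType) (d m n : nat)
    (A : 'M[R]_(m, n)) (b : 'cV[R]_m) : rel 'cV['I_d.+1]_n :=
  [rel x y | [&& x \in feasible d A b, y \in feasible d A b
               & hamming x y == 1%N]].

(* The empty graph (no feasible solution) counts as connected; otherwise no
   matrix with at least one row would be universally connected. *)
Definition solution_graph_connected (R : realType) (d m n : nat)
    (A : 'M[R]_(m, n)) (b : 'cV[R]_m) : Prop :=
  forall x y : 'cV['I_d.+1]_n,
    x \in feasible d A b -> y \in feasible d A b ->
    connect (solution_graph A b) x y.

Definition universally_connected (R : realType) (d m n : nat)
    (A : 'M[R]_(m, n)) : Prop :=
  forall b : 'cV[R]_m, solution_graph_connected d A b.

Definition ordering (T : finType) (k : nat) (s : 'I_k -> T) (S : {set T}) :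
    Prop :=
  injective s /\ [set s l | l : 'I_k] = S.

(* [ordS] is the cyclic successor on 'I_k: the last index is followed by 0. *)
Definition forbidden_pattern (R : realType) (m n : nat) (A : 'M[R]_(m, n))
    (I : {set 'I_m}) (J : {set 'I_n}) : Prop :=
  exists k : nat, [/\ #|I| = k, #|J| = k, k <> 0%N &
    exists (i : 'I_k -> 'I_m) (j : 'I_k -> 'I_n),
      [/\ ordering i I, ordering j J &
        forall l : 'I_k,
          (forall p, p \in I :\: [set i l; i (ordS l)] -> A p (j l) = 0) /\
          A (i l) (j l) * A (i (ordS l)) (j l) < 0]].

Definition has_forbidden_pattern (R : realType) (m n : nat)
    (A : 'M[R]_(m, n)) : Prop :=
  exists (I : {set 'I_m}) (J : {set 'I_n}), forbidden_pattern A I J.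

(* Main.v *)
Require Import Defs.
From mathcomp Require Import all_boot all_order all_algebra.
From mathcomp Require Import reals.
From mathcomp Require Import lra.

(* A forbidden pattern is a cycle, alternating in sign, in the bipartite graph
   of rows and columns.  Take a shortest such cycle.  A column having entries
   of opposite signs in two of its rows would be a chord unless these rows are
   the two neighbours of the column on the cycle, so if the cycle has at least
   three rows its columns vanish on its other rows, and every column off the
   cycle has constant sign on its rows.  Fix the latter columns at their best
   value; reversing D in some of the cycle columns, each row of the cycle
   becomes a constraint p x_l - q x_(l-1) >= b with p, q > 0.  For
   b = min(0, p - q), both x = 0 and x = (1, ..., 1) are feasible, but no
   coordinate of 0 on the cycle can be raised.  For cycles with two rows, the
   columns off the cycle with opposite signs have to be treated together with
   those of the cycle; see [two_rows_disconnect]. *)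

Set Implicit Arguments.
Unset Strict Implicit.
Unset Printing Implicit Defensive.

Import Order.TTheory GRing.Theory Num.Theory.
Local Open Scope ring_scope.

(** * Connectivity, signs and sequences *)

Lemma connect_invariant (T : finType) (e : rel T) (P : T -> Prop) (x y : T) :
  (forall z z', P z -> e z z' -> P z') -> P x -> connect e x y -> P y.
Proof.
move=> eP Px /connectP[p]; elim: p x Px => [|z p IHp] x Px /=.
  by move=> _ ->.
by case/andP=> exz; apply: IHp; apply: eP exz.
Qed.

Lemma mulr_sgr_opp (R : realDomainType) (a b : R) :
  a * b < 0 -> b * Num.sg a = - `|b|.
Proof.
case: sgrP => [->|a_gt0|a_lt0]; first by rewrite mul0r ltxx.
  by rewrite pmulr_rlt0 // => b_lt0; rewrite mulr1 ltr0_norm ?opprK.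
by rewrite nmulr_rlt0 // => b_gt0; rewrite mulrN1 gtr0_norm.
Qed.

Lemma mulr_lt0_neq0 (R : realDomainType) (a b : R) :
  a * b < 0 -> (a != 0) && (b != 0).
Proof. by move=> lt0; have := ltr0_neq0 lt0; rewrite mulf_eq0 negb_or. Qed.

Lemma mulr_lt0_split (R : realDomainType) (a b c : R) :
  a * b < 0 -> c != 0 -> (a * c < 0) || (b * c < 0).
Proof.
move=> ab_lt0 c_neq0; case: ltP => //= ac_ge0.
have : (a * c) * (b * c) < 0 by rewrite mulrACA -expr2 pmulr_llt0 ?exprn_even_gt0.
by rewrite !ltNge; apply: contraNN; apply: mulr_ge0.
Qed.

Lemma uniq_map_inj (T1 T2 : eqType) (f : T1 -> T2) (s : seq T1) :
  uniq (map f s) -> {in s &, injective f}.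
Proof.
elim: s => // a s IHs /= /andP[fa_notin /IHs inj_s] x y.
rewrite !inE => /predU1P[->|xs] /predU1P[->|ys] // eq_f; last exact: inj_s.
  by rewrite eq_f map_f in fa_notin.
by rewrite -eq_f map_f in fa_notin.
Qed.

(** * Chords of alternating cycles *)

Section AlternatingCycle.
Variables (R : realType) (m n : nat) (A : 'M[R]_(m, n)).
Implicit Types (s : seq ('I_m * 'I_n)) (p q : 'I_m * 'I_n).

(** A pair holds a row and the column that links it to the row of the next pair. *)
Definition alternating p q := A p.1 p.2 * A q.1 p.2 < 0.

(* A cycle of the bipartite graph of rows and columns in which the two visited
   entries of each column have opposite signs. *)
Definition alternating_cycle s :=
  [&& s != [::], uniq (map fst s), uniq (map snd s) & cycle alternating s].

Lemma alternating_cycle_rot k s :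
  alternating_cycle (rot k s) = alternating_cycle s.
Proof. by rewrite /alternating_cycle rot_cycle !map_rot !rot_uniq -!size_eq0 size_rot. Qed.

Definition minimal_cycle s :=
  alternating_cycle s /\
  forall s', alternating_cycle s' -> (size s <= size s')%N.

Lemma minimal_cycle_rot k s : minimal_cycle s -> minimal_cycle (rot k s).
Proof. by case=> cs mins; split; rewrite ?alternating_cycle_rot ?size_rot. Qed.

Lemma alternating_cycle_uniq s : alternating_cycle s -> uniq s.
Proof. by case/and4P=> _ + _ _; apply: map_uniq. Qed.

(** Closing the stretch from r to r' by c0 gives an alternating cycle without s2. *)
Lemma chord r c s1 r' c' s2 c0 :
  minimal_cycle ((r, c) :: s1 ++ (r', c') :: s2) -> A r c0 * A r' c0 < 0 ->
  c0 \notin c :: map snd s1 -> s2 = [::].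
Proof.
case=> /and4P[_ ur uc cyc] mins chord_lt0 c0_notin.
suff /mins : alternating_cycle (rcons ((r, c) :: s1) (r', c0)).
  by rewrite /= size_rcons size_cat /= addnS !ltnS -[leqRHS]addn0 leq_add2l leqn0 => /nilP.
apply/and4P; split=> //.
- rewrite map_rcons; apply: subseq_uniq ur.
  by rewrite -cats1 -cat_cons map_cat cat_subseq // sub1seq mem_head.
- rewrite map_rcons rcons_uniq /= c0_notin /=.
  by move: uc; rewrite /= map_cat cat_uniq mem_cat negb_or => /and3P[/andP[-> _] -> _].
- move: cyc; rewrite /= rcons_cat cat_path /= !rcons_path last_rcons.
  by case/and3P=> -> step _; apply/andP; split; rewrite // /alternating mulrC.
Qed.

(** A nonzero entry would be opposite in sign to one of the two cycle entries of the column, making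
    the column a chord. *)
Lemma minimal_cycle_col s p i :
  minimal_cycle s -> p \in s -> i \in map fst s ->
  i != p.1 -> i != (next s p).1 -> A i p.2 = 0.
Proof.
move=> mins ps; have us := alternating_cycle_uniq mins.1.
case/rot_to: ps => k s' rot_s; rewrite -(next_rot k) //.
rewrite -(mem_rot k) -map_rot; move: (minimal_cycle_rot k mins); rewrite {}rot_s {us mins}.
case: s' => [|q s'] mins; first by rewrite inE => /eqP-> /eqP.
rewrite /= eqxx !inE => + /negPf i_p /negPf i_q; rewrite i_p i_q /=.
case/mapP=> -[i' c] in_s' /= ->{i i_p i_q}; case/splitPr: in_s' mins => s1 s2 mins.
case: (mins) => /and4P[_ _ + /= /andP[pq _]] _; rewrite /= map_cat => /andP[p2_notin _].
apply: contraTeq pq => nz; apply/negP=> /mulr_lt0_split/(_ nz)/orP[].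
  (* Chord between i' and p.1: the shortcut skips q. *)
  rewrite mulrC => lt0; have := minimal_cycle_rot (size [:: p, q & s1]) mins.
  rewrite -[X in rot _ X]/([:: p, q & s1] ++ _) rot_size_cat; case: (p) lt0 p2_notin => rp cp /= lt0 p2_notin.
  move/chord=> /(_ _ lt0); move: p2_notin; rewrite !inE !mem_cat !inE !negb_or.
  by case/and4P=> _ _ -> -> /(_ isT).
(* Chord between q.1 and i': the shortcut skips p. *)
move=> lt0; have := minimal_cycle_rot 1 mins; rewrite rot1_cons rcons_cons rcons_cat rcons_cons.
case: (q) lt0 p2_notin => rq cq /= lt0 p2_notin /chord/(_ lt0).
move: p2_notin; rewrite !inE !mem_cat !inE !negb_or => /and4P[-> -> _ _] /(_ isT).
by case: s2 {mins}.
Qed.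

(** A column of mixed sign could close either arc of the cycle, so by [chord] neither arc has inner
    rows and the cycle has only two rows. *)
Lemma minimal_cycle_col_notin s l i i' :
  minimal_cycle s -> (2 < size s)%N -> l \notin map snd s ->
  i \in map fst s -> i' \in map fst s -> ~~ (A i l * A i' l < 0).
Proof.
move=> mins size_s l_notin /mapP[[r c] rs /= ->] i's; apply/negP=> lt0.
have i'r : i' != r.
  by apply: contraTneq lt0 => ->; rewrite -leNgt -expr2 sqr_ge0.
case/rot_to: rs => k s' rot_s; move: mins size_s l_notin i's.
move=> /(minimal_cycle_rot k); rewrite -(size_rot k) -(mem_rot k (map snd s)).
rewrite -(mem_rot k (map fst s)) -!map_rot {}rot_s /= => mins size_s l_notin.
rewrite inE (negPf i'r) => /mapP[[r' c'] /= in_s' eq_i']; rewrite {}eq_i' in lt0 i'r.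
case/splitPr: in_s' mins size_s l_notin => s1 s2 mins + l_notin.
move: (l_notin); rewrite map_cat /= !inE mem_cat inE !negb_or => /and4P[lc ls1 lc' ls2].
have -> : s2 = [::] by apply: chord mins lt0 _; rewrite inE negb_or lc.
have := minimal_cycle_rot (size ((r, c) :: s1)) mins.
rewrite -[X in rot _ X]/(((r, c) :: s1) ++ _) rot_size_cat mulrC in lt0 *.
by move/chord/(_ lt0) => -> //; rewrite inE negb_or lc'.
Qed.

End AlternatingCycle.

(** * Disconnected solution graphs *)

Section Disconnection.
Variables (R : realType) (d m n : nat) (A : 'M[R]_(m, n)).
Implicit Types x y z : 'cV['I_d.+1]_n.

Lemma mulmx_realvecB x y i :
  (A *m realvec R y) i 0 - (A *m realvec R x) i 0 =
  \sum_l A i l * ((y l 0)%:R - (x l 0)%:R).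
Proof.
rewrite !mxE -sumrB; apply: eq_bigr => l _.
by rewrite !mxE mulrBr.
Qed.

(* With b := min(Ax, Ay), the set of feasible points that agree with x on C is
   closed under adjacency, and it does not contain y. *)
Lemma isolation (I : pred 'I_m) (C : pred 'I_n) x y :
  (forall i l (v : 'I_d.+1), I i -> ~~ C l ->
     A i l * v%:R <= A i l * (x l 0)%:R) ->
  (forall l (v : 'I_d.+1), C l -> v != x l 0 -> exists2 i, I i &
     A i l * (v%:R - (x l 0)%:R) <
       Num.min 0 (\sum_k A i k * ((y k 0)%:R - (x k 0)%:R))) ->
  (exists2 l, C l & y l 0 != x l 0) ->
  ~ universally_connected d A.
Proof.
move=> maxx tightx [l0 Cl0 neq_yx] uc.
pose b := \col_i Num.min ((A *m realvec R x) i 0) ((A *m realvec R y) i 0).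
have feas_x : x \in feasible d A b.
  by rewrite inE; apply/forallP=> i; rewrite mxE ge_min lexx.
have feas_y : y \in feasible d A b.
  by rewrite inE; apply/forallP=> i; rewrite mxE ge_min lexx orbT.
move: (uc b x y feas_x feas_y) neq_yx => xy /eqP; apply; move: l0 Cl0.
apply: (connect_invariant (P := fun z => forall l, C l -> z l 0 = x l 0)) xy => //.
move=> z z' zx /and3P[_ + /cards1P[l0 eq_l0]] l Cl; rewrite inE => /forallP feas_z'.
have neqE k : (z k 0 != z' k 0) = (k == l0).
  by have := in_set1 k l0; rewrite -eq_l0 inE.
apply/eqP; apply: contraT => neq_l.
have ll0 : l = l0.
  by apply/eqP; rewrite -neqE zx // eq_sym.
have [i Ii] := tightx _ _ Cl neq_l.
rewrite -mulmx_realvecB lt_min => /andP[lt0 ltyx].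
(* On C, z' differs from x only at l; off C, x maximizes each term of row i. *)
have le_z' : (A *m realvec R z') i 0 - (A *m realvec R x) i 0 <=
             A i l * ((z' l 0)%:R - (x l 0)%:R).
  rewrite mulmx_realvecB (bigD1 l) //= gerDl; apply: sumr_le0 => k kl.
  have [Ck|nCk] := boolP (C k); last first.
    by rewrite mulrBr subr_le0; apply: maxx.
  have /eqP <- : z k 0 == z' k 0 by rewrite -[_ == _]negbK neqE -ll0 kl.
  by rewrite zx // subrr mulr0.
have := feas_z' i; rewrite [b i 0]mxE ge_min => /orP[]; move: lt0 ltyx le_z'; clear; lra.
Qed.

(* Counts the values of a coordinate from the end of D where its contribution
   to a row with coefficient a is least. *)
Definition orient (a : R) (t : 'I_d.+1) : 'I_d.+1 :=
  if 0 < a then t else rev_ord t.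

Lemma orientK a : involutive (orient a).
Proof. by move=> t; rewrite /orient; case: (0 < a); rewrite ?rev_ordK. Qed.

Lemma orientB a (t u : 'I_d.+1) : a != 0 ->
  (orient a t)%:R - (orient a u)%:R = Num.sg a * (t%:R - u%:R) :> R.
Proof.
rewrite /orient => /lt_total/orP[a_lt0|a_gt0]; last by rewrite a_gt0 gtr0_sg ?mul1r.
by rewrite ltNge (ltW a_lt0) ltr0_sg //= !subSS !natrB ?leq_ord //; lra.
Qed.

Definition extremal (I : pred 'I_m) (l : 'I_n) : 'I_d.+1 :=
  if [forall i, I i ==> (0 <= A i l)] then ord_max else ord0.

Lemma extremalP (I : pred 'I_m) l :
  (forall i i', I i -> I i' -> ~~ (A i l * A i' l < 0)) ->
  forall i (v : 'I_d.+1), I i -> A i l * v%:R <= A i l * (extremal I l)%:R.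
Proof.
move=> same i v Ii; rewrite /extremal; case: ifPn => [/forallP/(_ i)|].
  by rewrite Ii => ge0; rewrite ler_wpM2l // ler_nat leq_ord.
rewrite negb_forall => /existsP[i']; rewrite negb_imply -ltNge => /andP[Ii' lt0].
have := same i i' Ii Ii'; rewrite -leNgt mulr0 => ge0.
apply: mulr_le0_ge0 => //; nra.
Qed.

Hypothesis d_gt0 : (0 < d)%N.

Let one (b : bool) : 'I_d.+1 := inord b.

(** For d = 0, [inord] would fall back to 0 on [true]. *)
Let oneE b : (one b : nat) = b.
Proof. by rewrite inordK //; case: b. Qed.

(* After reorientation, row r has positive and row r' negative entries in every
   column of C.  The points e_c and e_c' are feasible; if c has the larger entry
   in r', then r' is tight at e_c and forbids raising any coordinate in C, while
   r forbids lowering the coordinate c to 0. *)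
Lemma two_rows_disconnect r r' c c' :
  A r c * A r' c < 0 -> A r c' * A r' c' < 0 -> c != c' ->
  ~ universally_connected d A.
Proof.
wlog le_c : c c' / `|A r' c'| <= `|A r' c|.
  move=> wlg hc hc' cc'; have [le_c|/ltW le_c] := lerP `|A r' c'| `|A r' c|.
    exact: wlg hc hc' cc'.
  by apply: wlg hc' hc _; rewrite // eq_sym.
move=> hc hc' neq_c. have neq_c' : c' != c by rewrite eq_sym.
pose I : pred 'I_m := pred2 r r'.
pose C : pred 'I_n := fun l => A r l * A r' l < 0.
pose pt k : 'cV['I_d.+1]_n :=
  \col_l if C l then orient (A r l) (one (l == k)) else extremal I l.
have ptB k k' i : C k -> C k' -> k != k' ->
    \sum_l A i l * ((pt k l 0)%:R - (pt k' l 0)%:R) =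
    A i k * Num.sg (A r k) - A i k' * Num.sg (A r k').
  move=> Ck Ck' kk'; rewrite (bigD1 k) // (bigD1 k') 1?eq_sym //=.
  rewrite !mxE Ck Ck' !orientB; try by have /andP[] := mulr_lt0_neq0 Ck.
    2: by have /andP[] := mulr_lt0_neq0 Ck'.
  rewrite !oneE !eqxx (negPf kk') eq_sym (negPf kk') big1 => [|l /andP[lk lk']].
    by rewrite /=; lra.
  by rewrite !mxE (negPf lk) (negPf lk') subrr mulr0.
apply: (@isolation I C (pt c) (pt c')).
- move=> i l v Ii nCl; rewrite mxE (negPf nCl); apply: extremalP Ii.
  move=> i1 i2 /pred2P[]-> /pred2P[]->; rewrite -?leNgt -?expr2 ?sqr_ge0 //.
    by rewrite leNgt.
  by rewrite mulrC leNgt.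
- move=> l v Cl; rewrite mxE Cl => v_neq.
  have /andP[nz nz'] := mulr_lt0_neq0 Cl.
  have /andP[cz cz'] := mulr_lt0_neq0 hc.
  have /andP[c'z c'z'] := mulr_lt0_neq0 hc'.
  rewrite -(orientK (A r l) v) in v_neq *; set t := orient _ v in v_neq *.
  have {v_neq} t_neq : t != one (l == c) by apply: contraNneq v_neq => ->.
  have rowr u : A r u * Num.sg (A r u) = `|A r u| by rewrite normrEsg mulrC.
  have rowr' u : C u -> A r' u * Num.sg (A r u) = - `|A r' u|.
    exact: mulr_sgr_opp.
  have t_neq' : (t != (l == c) :> nat)%N by rewrite -oneE.
  (* Only coordinate c can be lowered; row r then loses [|A r c|], more than on passing to e_c'. *)
  have [lt_t|ge_t] := ltnP t (l == c).
    have lc : l = c by apply/eqP; move: lt_t; case: (l == c).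
    exists r; first by rewrite /I /= eqxx.
    rewrite ptB // orientB // oneE mulrA !rowr lc eqxx.
    have -> : (t : nat) = 0%N by move: lt_t; rewrite lc eqxx; case: (t : nat).
    rewrite lt_min /=; have := normr_gt0 (A r c); have := normr_gt0 (A r c').
    by rewrite cz c'z => ? ?; apply/andP; split; lra.
  (* By [le_c], row r' is at least as large at e_c' as at e_c, so the minimum is 0. *)
  exists r'; first by rewrite /I /= eqxx orbT.
  rewrite ptB // orientB // oneE mulrA !rowr' //.
  have lt_t : (l == c)%:R < (t : nat)%:R :> R.
    by rewrite ltr_nat ltn_neqAle eq_sym t_neq'.
  have lt0 : - `|A r' l| * ((t : nat)%:R - (l == c)%:R) < 0.
    by rewrite mulNr oppr_lt0 mulr_gt0 ?subr_gt0 ?normr_gt0.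
  rewrite lt_min lt0 /=; apply: lt_le_trans lt0 _.
  by rewrite opprK addrC subr_ge0.
- have Cc : C c := hc; exists c; rewrite // !mxE Cc (inj_eq (can_inj (orientK _))) eqxx (negPf neq_c).
  by rewrite -val_eqE /= !oneE.
Qed.

Lemma long_cycle_disconnect s :
  minimal_cycle A s -> (2 < size s)%N -> ~ universally_connected d A.
Proof.
move=> mins size_s; have us := alternating_cycle_uniq mins.1.
have [/and4P[_ ur uc cyc] _] := mins.
have [p0 p0s] : exists p0, p0 \in s.
  by case: (s) size_s => // p0 s' _; exists p0; apply: mem_head.
have inj1 := uniq_map_inj ur.
(* The pair of the cycle with column l; p0 is only the default of [nth]. *)
pose own l := nth p0 s (index l (map snd s)).
have own_in p : p \in s -> own p.2 = p.
  exact: nth_index_map (uniq_map_inj uc).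
(* Each cycle column is oriented to be positive in its own row, hence negative in the next row,
   which will forbid raising it. *)
pose pt b : 'cV['I_d.+1]_n := \col_l
  if l \in map snd s then orient (A (own l).1 l) (one b)
  else extremal (mem (map fst s)) l.
have alt p : p \in s -> A p.1 p.2 * A (next s p).1 p.2 < 0.
  exact: next_cycle cyc.
have ptE p b : p \in s -> pt b p.2 0 = orient (A p.1 p.2) (one b).
  by move=> ps; rewrite mxE map_f // own_in.
have ptB p : p \in s ->
    (pt true p.2 0)%:R - (pt false p.2 0)%:R = Num.sg (A p.1 p.2) :> R.
  move=> ps; rewrite !ptE // orientB ?oneE ?subr0 ?mulr1 //.
  by have /andP[] := mulr_lt0_neq0 (alt p ps).
apply: (@isolation (mem (map fst s)) (mem (map snd s)) (pt false) (pt true)).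
- move=> i l v Ii l_notin; have {}l_notin : l \notin map snd s := l_notin.
  rewrite mxE (negPf l_notin); apply: extremalP Ii => i1 i2.
  exact: minimal_cycle_col_notin.
- move=> l v /mapP[p ps ->]; rewrite ptE // => v_neq.
  have p_alt := alt p ps; have /andP[nz nz'] := mulr_lt0_neq0 p_alt.
  set q := next s p in p_alt nz'.
  have qs : q \in s by rewrite mem_next.
  have /andP[qnz _] := mulr_lt0_neq0 (alt q qs).
  rewrite -(orientK (A p.1 p.2) v) in v_neq *; set t := orient _ v in v_neq *.
  have t_gt0 : (0 < t)%N.
    rewrite lt0n; apply: contraNneq v_neq => t0.
    by apply/eqP; congr orient; apply: val_inj; rewrite /= t0 oneE.
  exists q.1; first exact: map_f.
  rewrite orientB // oneE subr0 mulrA mulr_sgr_opp //.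
  have lt0 : - `|A q.1 p.2| * (t : nat)%:R < 0.
    by rewrite mulNr oppr_lt0 mulr_gt0 ?normr_gt0 ?ltr0n.
  rewrite lt_min lt0 /=.
  have qp : q.2 != p.2.
    apply: contraTneq p_alt => eq_qp; have -> : q = p by rewrite -(own_in q) // eq_qp own_in.
    by rewrite -leNgt -expr2 sqr_ge0.
  (* Row q.1 vanishes on all other cycle columns, so it changes by [|A q.1 q.2| - |A q.1 p.2|]
     between the two points. *)
  rewrite (bigD1 p.2) // (bigD1 q.2) //= big1 => [|k /andP[kp kq]]; last first.
    have [/mapP[u us' eq_k]|k_notin] := boolP (k \in map snd s); last first.
      by rewrite !mxE (negPf k_notin) subrr mulr0.
    rewrite {}eq_k in kp kq *; rewrite (minimal_cycle_col mins us') ?mul0r ?map_f //.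
      by apply: contraNneq kq => /inj1 ->.
    apply: contraNneq kp => /inj1 eq_q.
    by rewrite -(prev_next us p) -/q eq_q ?mem_next // prev_next.
  rewrite !ptB // mulr_sgr_opp // [A q.1 q.2 * _]mulrC -normrEsg addr0.
  apply: le_lt_trans (_ : - `|A q.1 p.2| < _); last by rewrite ltrDl normr_gt0.
  by rewrite mulNr lerN2 ler_peMr // ler1n.
- exists p0.2; first exact: map_f.
  by rewrite !ptE // (inj_eq (can_inj (orientK _))) -val_eqE /= !oneE.
Qed.

Lemma universally_connected_acyclic s :
  universally_connected d A -> ~~ alternating_cycle A s.
Proof.
move=> uc; have [k] := ubnP (size s); elim: k s => // k IHk s lt_s.
apply/negP=> cs; have mins : minimal_cycle A s.
  (* Shorter cycles are excluded by induction. *)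
  split=> // s' cs'; rewrite leqNgt; apply/negP=> lt_s'.
  by have /negP[] := IHk s' (leq_trans lt_s' lt_s).
case: (ltnP 2 (size s)) => [/long_cycle_disconnect/(_ uc)|]; first exact.
case/and4P: cs {mins lt_s}; case: s => [|[r c] [|[r' c'] []]] // _ _.
  (* A cycle with one pair would make a square negative. *)
  by move=> _ /=; rewrite andbT /alternating ltNge -expr2 sqr_ge0.
rewrite /= inE !andbT /alternating /= => neq_c /andP[lt0 lt0'] _.
by apply: two_rows_disconnect lt0 _ neq_c uc; rewrite mulrC.
Qed.

End Disconnection.


(** * From forbidden patterns to alternating cycles *)

Theorem theorem1 (R : realType) (d m n : nat) (d_gt0 : (0 < d)%N)
    (A : 'M[R]_(m, n)) :
  universally_connected d A -> ~ has_forbidden_pattern A.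
Proof.
move=> uc [I [J [k [_ _ k_neq0 [i [j [[i_inj _] [j_inj _] pattern]]]]]]].
case: k k_neq0 i j i_inj j_inj pattern => // k _ i j i_inj j_inj pattern.
(* The orbit of [ord0] under [ordS] lists the indices in the cyclic order of the pattern. *)
pose s := [seq (i l, j l) | l <- orbit (@ordS k.+1) ord0].
have /negP[] := universally_connected_acyclic d_gt0 s uc.
apply/and4P; split.
- by rewrite -size_eq0 size_map size_eq0; have := in_orbit (@ordS k.+1) ord0; case: orbit.
- by rewrite -map_comp map_inj_uniq ?orbit_uniq.
- by rewrite -map_comp map_inj_uniq ?orbit_uniq.
- rewrite cycle_map; apply: sub_cycle (cycle_orbit (@ordS_inj k.+1) ord0).
  by move=> l _ /= /eqP <-; have [] := pattern l.
Qed.
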